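(* Let $\alpha_1,\alpha_2,\beta_1,\beta_2>0$ and let $\{X(t):t\geq 0\}$ be the continuous-time Markov chain on $\mathbb{Z}$ with alternating rates described in the context. For $k\in\mathbb{Z}$, $t\geq 0$ let $F_k(z,t):=\mathbb{E}[z^{X(t)}|X(0)=k]=\sum_{n=-\infty}^{\infty}z^n p_{k,n}(t)$. Then, for every $z>0$, $$F_k(z,t)=z^k e^{-\frac{\alpha_1+\alpha_2+\beta_1+\beta_2}{2}t}\left(\cosh\left(\frac{t\,h(z)}{z}\right)+\frac{c_k(z)}{h(z)}\sinh\left(\frac{t\,h(z)}{z}\right)\right),$$ where $$c_k(z):=\begin{cases}\frac{(\beta_1+\beta_2-(\alpha_1+\alpha_2))z}{2}+\alpha_1z^2+\alpha_2 & \text{if } k \text{ is even},\\ \frac{(\alpha_1+\alpha_2-(\beta_1+\beta_2))z}{2}+\beta_1z^2+\beta_2 & \text{if } k \text{ is odd}.\end{cases}$$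
   Context: $\{X(t):t\geq 0\}$ is the continuous-time Markov chain on $\mathbb{Z}$ whose state probabilities $p_{k,n}(t):=P(X(t)=n|X(0)=k)$ satisfy $p_{k,n}(0)=1_{\{k=n\}}$ and whose generator $g_{k,n}:=\lim_{t\to 0}\frac{p_{k,n}(t)-p_{k,n}(0)}{t}$ is as follows. For even $k$: $g_{k,k+1}=\alpha_1$, $g_{k,k-1}=\alpha_2$, $g_{k,k}=-(\alpha_1+\alpha_2)$. For odd $k$: $g_{k,k+1}=\beta_1$, $g_{k,k-1}=\beta_2$, $g_{k,k}=-(\beta_1+\beta_2)$. All other entries are $0$. The function $h$ is $$h(z):=\frac12\sqrt{(\alpha_1+\alpha_2-(\beta_1+\beta_2))^2z^2+4(\beta_1z^2+\beta_2)(\alpha_1z^2+\alpha_2)}.$$ *)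

(* Defs.v *)
From HB Require Import structures.
From mathcomp Require Import all_boot all_order all_algebra.
From mathcomp Require Import all_classical all_reals all_analysis.
Import Order.TTheory GRing.Theory Num.Theory.
Import numFieldNormedType.Exports.

Set Implicit Arguments.
Unset Strict Implicit.
Unset Printing Implicit Defensive.

Local Open Scope classical_set_scope.
Local Open Scope ring_scope.

Definition cosh (R : realType) (x : R) : R := (expR x + expR (- x)) / 2.
Definition sinh (R : realType) (x : R) : R := (expR x - expR (- x)) / 2.

(* [P k] is the law of the process given X(0) = k, so that the conditional
   probability P(A | X(0) = k) is written [P k A].  Only the times t >= 0 of
   [X : R -> T -> int] are meaningful. *)

Definition transition_prob (R : realType) (d : measure_display)
    (T : measurableType d) (P : int -> probability T R) (X : R -> T -> int)
    (k n : int) (t : R) : R :=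
  fine (P k [set w | X t w = n]).

(* The Markov property is stated as
     P_k(H, X(t_m + s) = n) = P_k(H) * p_{j_m, n}(s)
   with H the event X(t_0) = j_0, ..., X(t_m) = j_m.  When P_k(H) > 0 this says
   that P_k(X(t_m + s) = n | H) = p_{j_m, n}(s); when P_k(H) = 0 both sides
   vanish.  The s-dependence alone on the right is time-homogeneity. *)
Record is_markov_chain (R : realType) (d : measure_display)
    (T : measurableType d) (P : int -> probability T R)
    (X : R -> T -> int) : Prop := IsMarkovChain {
  markov_measurable : forall (t : R) (n : int), 0 <= t ->
    measurable [set w | X t w = n];
  markov_start : forall k : int, P k [set w | X 0 w = k] = 1%E;
  markov_property :
    forall (k : int) (m : nat) (tau : nat -> R) (j : nat -> int)
           (s : R) (n : int),
    0 <= tau 0%N -> (forall i, (i < m)%N -> tau i <= tau i.+1) -> 0 <= s ->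
    let H := [set w | forall i, (i <= m)%N -> X (tau i) w = j i] in
    P k (H `&` [set w | X (tau m + s) w = n]) =
      (P k H * P (j m) [set w | X s w = n])%E
}.

Definition has_generator (R : realType) (d : measure_display)
    (T : measurableType d) (P : int -> probability T R) (X : R -> T -> int)
    (g : int -> int -> R) : Prop :=
  forall k n : int,
    (transition_prob P X k n t - transition_prob P X k n 0) / t
      @[t --> 0^'+] --> g k n.

Definition alternating_rate (R : realType) (a1 a2 b1 b2 : R)
    (k n : int) : R :=
  let up := if (2 %| k)%Z then a1 else b1 in
  let down := if (2 %| k)%Z then a2 else b2 in
  if n == k + 1 then up
  else if n == k - 1 then down
  else if n == k then - (up + down)
  else 0.

(* Extended-real valued, hence meaningful before finiteness is known. *)
Definition gen_fun (R : realType) (d : measure_display)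
    (T : measurableType d) (P : int -> probability T R) (X : R -> T -> int)
    (k : int) (z t : R) : \bar R :=
  ('E_(P k)[fun w => z ^ X t w])%E.

Definition h_fun (R : realType) (a1 a2 b1 b2 z : R) : R :=
  1 / 2 * Num.sqrt ((a1 + a2 - (b1 + b2)) ^+ 2 * z ^+ 2
                    + 4 * (b1 * z ^+ 2 + b2) * (a1 * z ^+ 2 + a2)).

Definition c_fun (R : realType) (a1 a2 b1 b2 : R) (k : int) (z : R) : R :=
  if (2 %| k)%Z then (b1 + b2 - (a1 + a2)) * z / 2 + a1 * z ^+ 2 + a2
  else (a1 + a2 - (b1 + b2)) * z / 2 + b1 * z ^+ 2 + b2.

(* Main.v *)
(* Only the derivatives at 0 are given.  With the Markov property they yield
   the backward equations p_{k,n}' = sum_j g_{k,j} p_{j,n}, because the mass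
   that p_{k,.}(s) puts outside {k-1, k, k+1} is o(s).  The formula w_z(k, t)
   solves the same system with initial value z^k, and solutions are compared by
   a maximum principle: a solution bounded below on Z x [0, t] and nonnegative
   at time 0 stays nonnegative.  Applied to w_z - S_N, where S_N is the sum of
   z^n p_{k,n}(t) over |n| <= N, it gives S_N <= w_z; applied to
   S_N - w_z + 2^-N (w_y + w_{1/y}) for y large, it gives the converse up to an
   error that vanishes as N grows. *)
Require Import Defs.
From HB Require Import structures.
From mathcomp Require Import all_boot all_order all_algebra.
From mathcomp Require Import all_classical all_reals all_analysis.
From mathcomp Require Import measurable_realfun ring lra zify.
Import Order.TTheory GRing.Theory Num.Theory.
Import numFieldNormedType.Exports.
Set Implicit Arguments.
Unset Strict Implicit.
Unset Printing Implicit Defensive.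
Local Open Scope classical_set_scope.
Local Open Scope ring_scope.

(** * Integer-valued random variables: sums over levels *)

Definition zball (N : nat) : seq int :=
  [seq (i%:Z - N%:Z)%R | i <- iota 0 N.*2.+1].

Lemma zball_uniq N : uniq (zball N).
Proof. by rewrite map_inj_uniq ?iota_uniq// => i j; lia. Qed.

Lemma mem_zball N (n : int) : (n \in zball N) = (absz n <= N)%N.
Proof.
apply/mapP/idP => [[i]|nN]; first by rewrite mem_iota => iN ->; lia.
by exists (absz (n + N%:Z)); [rewrite mem_iota; lia|lia].
Qed.

Section integer_valued.
Context (R : realType) (d : measure_display) (T : measurableType d).
Variables (mu : probability T R) (Y : T -> int).
Hypothesis mY : forall n, measurable [set w | Y w = n].
Implicit Type A : seq int.

Lemma trivIset_level (D : set int) : trivIset D (fun n => [set w | Y w = n]).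
Proof. by move=> i j _ _ [w [/= <- <-]]. Qed.

Lemma level_bigsetU A :
  [set w | Y w \in A] = \big[setU/set0]_(n <- A) [set w | Y w = n].
Proof.
elim: A => [|a A IH]; first by rewrite big_nil; apply/seteqP; split.
rewrite big_cons -IH; apply/seteqP; split => w /=; rewrite inE.
  by case/orP => [/eqP ->|]; [left|right].
by case=> [->|->]; rewrite ?eqxx ?orbT.
Qed.

Lemma measurable_levels A : measurable [set w | Y w \in A].
Proof. by rewrite level_bigsetU; exact: bigsetU_measurable. Qed.

(** Every preimage is a union of levels [[set w | Y w = n]], of which there are countably many. *)
Lemma measurable_int_comp (f : int -> R) :
  measurable_fun setT (fun w => f (Y w)).
Proof.
move=> _ B mB; rewrite setTI.
rewrite (_ : _ @^-1` _ =
    \bigcup_n (if f n \in B then [set w | Y w = n] else set0)).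
  apply: countable_bigcupT_measurable; first exact: countableP.
  by move=> n; case: ifP.
apply/seteqP; split => w /=.
  by move=> fB; exists (Y w) => //; rewrite mem_set.
by case=> n _; case: ifPn => // /set_mem fB /= ->.
Qed.

Lemma probability_levels (E : set T) A : measurable E -> uniq A ->
  fine (mu (E `&` [set w | Y w \in A])) =
  \sum_(n <- A) fine (mu (E `&` [set w | Y w = n])).
Proof.
move=> mE; elim: A => [_|a A IH /= /andP[aA uA]].
  by rewrite big_nil (_ : _ `&` _ = set0) ?measure0// -subset0 => w [].
rewrite big_cons -IH// -fineD; last 2 first.
- by apply: fin_num_measure; exact: measurableI.
- by apply: fin_num_measure; apply: measurableI => //; exact: measurable_levels.
rewrite -measureU; last 3 first.
- exact: measurableI.
- by apply: measurableI => //; exact: measurable_levels.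
- by rewrite -subset0 => w /= [[_ ->] [_]]; apply/negP.
congr (fine (mu _)); rewrite -setIUr; congr (_ `&` _).
apply/seteqP; split => w /=; rewrite inE.
  by case/orP => [/eqP ->|]; [left|right].
by case=> [->|->]; rewrite ?eqxx ?orbT.
Qed.

Lemma integral_levels (f : int -> R) A : uniq A -> (forall n, 0 <= f n) ->
  (\int[mu]_(w in [set w | Y w \in A]) (f (Y w))%:E =
   (\sum_(n <- A) f n * fine (mu [set w | Y w = n]))%:E)%E.
Proof.
move=> uA f0; rewrite level_bigsetU ge0_integral_bigsetU//.
- rewrite -sumEFin; apply: eq_bigr => n _.
  rewrite (eq_integral (cst (f n)%:E)); last by move=> w /set_mem /= ->.
  by rewrite integral_cst// EFinM fineK// fin_num_measure.
- exact: trivIset_level.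
- exact/measurable_EFinP/measurable_funTS/measurable_int_comp.
- by move=> w _; rewrite lee_fin.
Qed.

(** Monotone convergence along the events [absz Y <= N], which increase to the whole space. *)
Lemma expectation_zball (f : int -> R) : (forall n, 0 <= f n) ->
  (\sum_(n <- zball N) f n * fine (mu [set w | Y w = n]))%:E @[N --> \oo]
    --> ('E_mu[fun w => f (Y w)])%E.
Proof.
move=> f0; under eq_fun do rewrite -(integral_levels (zball_uniq _))//.
rewrite unlock (_ : setT = \bigcup_N [set w | Y w \in zball N]).
  apply: ge0_nondecreasing_set_cvg_integral.
  - move=> m n mn; rewrite subsetEset => w /=; rewrite !mem_zball => wm.
    exact: leq_trans mn.
  - by move=> N; exact: measurable_levels.
  - by move=> N; exact/measurable_EFinP/measurable_funTS/measurable_int_comp.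
  - by move=> N w _; rewrite lee_fin.
by apply/seteqP; split => w // _; exists (absz (Y w)) => //=; rewrite mem_zball.
Qed.

(** Sums over [zball N] are finite subsums that tend to the expectation, which gives one inequality.
    Any finite subsum is an integral over an event, which gives the other. *)
Lemma expectation_esum (f : int -> R) : (forall n, 0 <= f n) ->
  ('E_mu[fun w => f (Y w)] =
   \esum_(n in [set: int]) (f n * fine (mu [set w | Y w = n]))%:E)%E.
Proof.
move=> f0; apply/eqP; rewrite eq_le; apply/andP; split.
  have /cvg_lim <-// := expectation_zball f0.
  apply: lime_le; first by apply: cvgP; exact: expectation_zball.
  apply: nearW => N; apply: esum_ge; exists [set` zball N] => //.
    by split; [exact: finite_seq|].
  by rewrite -fsbig_seq ?zball_uniq// sumEFin.
apply: ge_ereal_sup => _ /= [F [/finite_fsetP[B ->] _] <-].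
have uB := finmap.fset_uniq B.
rewrite -fsbig_seq//= sumEFin -integral_levels//.
rewrite unlock; apply: ge0_subset_integral => //=.
- exact: measurable_levels.
- exact/measurable_EFinP/measurable_int_comp.
- by move=> w _; rewrite lee_fin.
Qed.

End integer_valued.

(** * Backward equations and the maximum principle *)

Lemma is_derive_expRM (R : realType) (c x : R) :
  is_derive x 1 (fun y => expR (c * y)) (c * expR (c * x)).
Proof.
have ? : is_derive x 1 (fun y : R => c * y) c.
  by apply: is_derive_eq; rewrite /GRing.scale/= mulr1.
by apply: is_derive_eq (is_derive1_comp _ _) _; rewrite mulrC.
Qed.

Section backward_equation.
Variable R : realType.
Implicit Types (up down : int -> R) (D : int -> R -> R).

(** Kolmogorov's backward system for nearest-neighbour jumps. Transition probabilities mean nothing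
    at negative times; hence right-continuity at 0, and two-sided derivatives at [t > 0] only. *)
Definition backward_solution up down D := forall k,
  D k s @[s --> 0^'+] --> D k 0 /\
  forall t : R, 0 < t -> is_derive t 1 (D k)
    (up k * (D (k + 1) t - D k t) + down k * (D (k - 1) t - D k t)).

Lemma backward_solutionD up down (c1 c2 : R) D1 D2 :
  backward_solution up down D1 -> backward_solution up down D2 ->
  backward_solution up down (fun k t => c1 * D1 k t + c2 * D2 k t).
Proof.
move=> h1 h2 k; have [c01 d1] := h1 k; have [c02 d2] := h2 k; split.
  by apply: cvgD; apply: cvgM => //; exact: cvg_cst.
move=> t t0; have := d1 _ t0; have := d2 _ t0 => ? ?.
by apply: is_derive_eq; rewrite /GRing.scale/=; ring.
Qed.

Lemma backward_solution_sum up down (I : eqType) (A : seq I) (c : I -> R)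
    (D : I -> int -> R -> R) :
  (forall i, backward_solution up down (D i)) ->
  backward_solution up down (fun k t => \sum_(i <- A) c i * D i k t).
Proof.
move=> hD; elim: A => [|i A IH].
  move=> k; split.
    by under eq_fun do rewrite big_nil; rewrite big_nil; exact: cvg_cst.
  move=> t _; under eq_fun do rewrite big_nil.
  by apply: is_derive_eq; rewrite !big_nil subrr !mulr0 addr0.
have {IH} := backward_solutionD (c i) 1 (hD i) IH.
by congr backward_solution; apply/funext => k; apply/funext => t;
  rewrite big_cons mul1r.
Qed.

(** The integrating factor [expR (qk * s)] removes the diagonal term: the derivative of [g] involves
    only [D (k + 1) s + M] and [D (k - 1) s + M], both nonnegative, so [g t >= g 0 >= M]. As [q]
    bounds all total rates, the gain is uniform in [k]. *)
Lemma backward_solution_improve up down (q tau M : R) D :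
  (forall k, 0 <= up k) -> (forall k, 0 <= down k) ->
  (forall k, up k + down k <= q) -> backward_solution up down D ->
  (forall k, 0 <= D k 0) -> 0 <= M ->
  (forall k (t : R), 0 <= t <= tau -> - M <= D k t) ->
  forall k (t : R), 0 <= t <= tau -> - (M * (1 - expR (- (q * tau)))) <= D k t.
Proof.
move=> up0 down0 hq hD D0 M0 hM k t /andP[t0 ttau].
set qk := up k + down k; have qk0 : 0 <= qk by rewrite addr_ge0.
have qkq : qk <= q by exact: hq.
have tau0 : 0 <= tau by exact: le_trans ttau.
pose g s := expR (qk * s) * (D k s + M).
have [c0 dD] := hD k.
have dg (s : R) : 0 < s -> is_derive s 1 g
    (expR (qk * s) * (up k * (D (k + 1) s + M) + down k * (D (k - 1) s + M))).
  move=> s0; have := dD _ s0 => ?.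
  have ? := is_derive_expRM qk s.
  by apply: is_derive_eq; rewrite /GRing.scale/= /qk; ring.
suff : M <= g t.
  move=> Mg; have : M * expR (- (qk * t)) <= D k t + M.
    by rewrite expRN ler_pdivrMr ?expR_gt0// mulrC.
  have : M * expR (- (q * tau)) <= M * expR (- (qk * t)).
    by rewrite ler_wpM2l// ler_expR lerN2 ler_pM.
  by move=> h1 h2; rewrite mulrBr mulr1; lra.
apply: (@le_trans _ _ (g 0)).
  by rewrite /g mulr0 expR0 mul1r lerDr D0.
have [->//|tN0] := eqVneq t 0.
have {tN0} t_gt0 : 0 < t by rewrite lt_neqAle eq_sym tN0.
have cg (s : R) : 0 < s -> {for s, continuous g}.
  by move=> /dg[/derivable1_diffP dgs _]; exact: differentiable_continuous.
apply: (@ger0_derive1_ndecr _ g 0 t) => //.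
- by move=> s; rewrite in_itv/= => /andP[/dg /@ex_derive].
- move=> s; rewrite in_itv/= => /andP[s0 st]; rewrite derive1E.
  have [_ ->] := dg _ s0.
  have hs : 0 <= s <= tau by rewrite ltW//= (le_trans (ltW st)).
  rewrite mulr_ge0 ?expR_ge0// addr_ge0// mulr_ge0//.
  + by have := hM (k + 1) _ hs; lra.
  + by have := hM (k - 1) _ hs; lra.
- apply/continuous_within_itvP => //; split.
  + by move=> s; rewrite inE/= => /andP[/cg].
  + apply: cvgM; last by apply: cvgD => //; exact: cvg_cst.
    apply: cvg_at_right_filter.
    apply: continuous_comp; last exact: continuous_expR.
    by apply: cvgM; [exact: cvg_cst|exact: cvg_id].
  + by apply: cvg_at_left_filter; exact: cg.
Qed.

(* Each use of [backward_solution_improve] shrinks the lower bound by the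
   factor [1 - exp (- q tau) < 1], so that the optimal one is nonnegative. *)
Lemma backward_solution_ge0 up down (q tau M : R) D :
  (forall k, 0 <= up k) -> (forall k, 0 <= down k) ->
  (forall k, up k + down k <= q) -> backward_solution up down D ->
  (forall k, 0 <= D k 0) ->
  (forall k (t : R), 0 <= t <= tau -> - M <= D k t) ->
  forall k (t : R), 0 <= t <= tau -> 0 <= D k t.
Proof.
move=> up0 down0 hq hD D0 hM k t ht.
have tau0 : 0 <= tau by case/andP: ht; exact: le_trans.
have q0 : 0 <= q by apply: le_trans (hq 0); rewrite addr_ge0.
set rho := 1 - expR (- (q * tau)).
have rho0 : 0 <= rho by rewrite subr_ge0 expR_le1// oppr_le0 mulr_ge0.
have rho1 : rho < 1 by rewrite ltrBlDr ltrDl expR_gt0.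
(* The improvement step needs a nonnegative bound and the sign of [M] is unknown, so the induction
   starts from its absolute value. *)
have hn n : forall k (t : R), 0 <= t <= tau ->
  - (geometric `|M| rho n) <= D k t.
  elim: n => [|n IH] j s hs.
    rewrite /= expr0 mulr1; apply: le_trans (hM j s hs).
    by rewrite lerN2 ler_norm.
  rewrite /= exprSr mulrA; apply: (backward_solution_improve _ _ hq hD) => //.
  by rewrite mulr_ge0// exprn_ge0.
have : - geometric `|M| rho n @[n --> \oo] --> (- 0 : R).
  by apply: cvgN; apply: cvg_geometric; rewrite ger0_norm.
by rewrite oppr0 => /cvgr_to_le; apply; apply: nearW => n; exact: hn.
Qed.

End backward_equation.

(** * Differentiability from uniform forward increments *)

Section increments.
Variable R : realType.

Lemma cvg_squeeze_norm (T : Type) (F : set_system T) {FF : Filter F}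
    (u r : T -> R) (l : R) :
  (\near F, `|u F - l| <= r F) -> r @ F --> 0 -> u @ F --> l.
Proof.
move=> ur r0.
apply: (@squeeze_cvgr _ _ _ _ (fun x => l - r x) (fun x => l + r x)).
- by apply: filterS ur => x; rewrite ler_distl.
- by rewrite -[X in _ --> X]subr0; apply: cvgB => //; exact: cvg_cst.
- by rewrite -[X in _ --> X]addr0; apply: cvgD => //; exact: cvg_cst.
Qed.

Variables (f v r : R -> R) (C : R).
Hypothesis fE : forall t s, 0 <= t -> 0 < s ->
  `|f (t + s) - f t - s * v t| <= s * r s.
Hypothesis r0 : r s @[s --> 0^'+] --> 0.
Hypothesis vC : forall t, 0 <= t -> `|v t| <= C.

Let cvg_modulus : s * (r s + C) @[s --> 0^'+] --> 0.
Proof.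
rewrite -[X in _ --> X](mul0r (0 + C)); apply: cvgM.
  by apply: cvg_at_right_filter; exact: cvg_id.
by apply: cvgD => //; exact: cvg_cst.
Qed.

Let modulus t s : 0 <= t -> 0 < s -> `|f (t + s) - f t| <= s * (r s + C).
Proof.
move=> t0 s0; rewrite -[X in `|X|](subrK (s * v t)).
rewrite (le_trans (ler_normD _ _))// mulrDr lerD ?fE//.
by rewrite normrM gtr0_norm// ler_wpM2l ?vC// ltW.
Qed.

Lemma increments_cvg_right0 : f s @[s --> 0^'+] --> f 0.
Proof.
apply: cvg_squeeze_norm cvg_modulus.
by near=> s; rewrite -[s in f s]add0r modulus.
Unshelve. all: by end_near. Qed.

(** The modulus of continuity is uniform in the base point, so it may be applied from [t - s], which
    moves with [s]. *)
Lemma increments_cvg_left t : 0 < t -> f (t - s) @[s --> 0^'+] --> f t.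
Proof.
move=> t0; apply: cvg_squeeze_norm cvg_modulus.
near=> s; rewrite distrC -[t in f t](subrK s) modulus//.
by rewrite subr_ge0; near: s; exact: nbhs_right_le.
Unshelve. all: by end_near. Qed.

(** The right derivative is the increment estimate divided by [s]. On the left, the same estimate
    based at [t - s] yields [v (t - s)], which tends to [v t] by assumption. *)
Lemma increments_is_derive t : 0 < t ->
  v (t - s) @[s --> 0^'+] --> v t -> is_derive t 1 f (v t).
Proof.
move=> t0 vt.
suff df : h^-1 *: ((f \o shift t) (h *: (1 : R)) - f t) @[h --> 0^'] --> v t.
  by apply: DeriveDef; [exact: cvgP df|exact: cvg_lim df].
apply: (@cvg_at_right_left_dnbhs _ R^o).
  apply: cvg_squeeze_norm r0; near=> s; have s0 : 0 < s by [].
  rewrite -(ler_pM2l s0) /GRing.scale/= mulr1 -{1}(gtr0_norm s0) -normrM.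
  rewrite mulrBr mulrA divff ?gt_eqF// mul1r addrC addrC [s + t]addrC.
  by apply: fE => //; exact: ltW.
apply/cvg_at_leftNP; rewrite oppr0.
have : r s + `|v (t - s) - v t| @[s --> 0^'+] --> 0.
  rewrite -[X in _ --> X]addr0; apply: cvgD => //.
  apply/norm_cvg0P; rewrite -[X in _ --> X](subrr (v t)).
  by apply: cvgB => //; exact: cvg_cst.
apply: cvg_squeeze_norm; near=> s; have s0 : 0 < s by [].
have st : 0 <= t - s by rewrite subr_ge0; near: s; exact: nbhs_right_le.
rewrite /= /GRing.scale/= mulr1 -[X in `|X|](subrKA (v (t - s))).
rewrite (le_trans (ler_normD _ _))// lerD2r.
rewrite -(ler_pM2l s0) -{1}(gtr0_norm s0) -normrM.
apply: le_trans (fE st s0); rewrite subrK [- s + t]addrC.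
rewrite (_ : s * _ = f t - f (t - s) - s * v (t - s))//; field.
by rewrite gt_eqF.
Unshelve. all: by end_near. Qed.

End increments.

(** * From the Markov property to the backward equations *)

Section nearest_neighbour.
Context (R : realType) (d : measure_display) (T : measurableType d).
Variables (P : int -> probability T R) (X : R -> T -> int).
Hypothesis hX : is_markov_chain P X.
Local Notation p := (transition_prob P X).

Lemma transition_prob_ge0 k n t : 0 <= p k n t.
Proof. exact: fine_ge0. Qed.

Lemma transition_prob_le1 k n t : 0 <= t -> p k n t <= 1.
Proof.
move=> t0; rewrite -lee_fin fineK ?fin_num_measure//.
  by apply: probability_le1; exact: markov_measurable hX _ _ t0.
exact: markov_measurable hX _ _ t0.
Qed.

Lemma transition_prob0 k n : p k n 0 = (n == k)%:R.
Proof.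
have mX n' := markov_measurable hX n' (lexx (0 : R)).
rewrite /transition_prob; have [->|nk] := eqVneq n k.
  by rewrite markov_start.
suff -> : P k [set w | X 0 w = n] = 0%E by [].
apply/eqP; rewrite eq_le measure_ge0 andbT.
(* The events [X 0 = n] and [X 0 = k] are disjoint, and the second already has mass 1. *)
have := probability_le1 (P k) (measurableU _ _ (mX n) (mX k)).
rewrite measureU//; last first.
  by rewrite -subset0 => w /= [-> nk']; rewrite nk' eqxx in nk.
have := markov_start hX k; rewrite /= => -> h.
by rewrite -(leeD2rE _ _ (_ : 1%E \is a fin_num))// add0e.
Qed.

(** The error is the probability that [X (s + t) = n] while [X s] lies outside [A], hence at most
    the probability that [X s] lies outside [A]. A finite [A] avoids series. *)
Lemma chapman_kolmogorov_approx k n (A : seq int) s t :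
  0 <= s -> 0 <= t -> uniq A ->
  `|p k n (s + t) - \sum_(j <- A) p k j s * p j n t|
     <= 1 - \sum_(j <- A) p k j s.
Proof.
move=> s0 t0 uA; have mX u m u0 := @markov_measurable _ _ _ _ _ hX u m u0.
have st0 : 0 <= s + t by rewrite addr_ge0.
set E := [set w | X (s + t) w = n]; have mE : measurable E by exact: mX.
have mU : measurable [set w | X s w \in A].
  by apply: measurable_levels => m; exact: mX.
have -> : \sum_(j <- A) p k j s * p j n t =
    fine (P k (E `&` [set w | X s w \in A])).
  rewrite (probability_levels (P k) (fun m => mX s m s0))//.
  apply: eq_bigr => j _.
  rewrite /transition_prob -fineM ?fin_num_measure//; try exact: mX.
  have HE : [set w | forall i, (i <= 0)%N -> X s w = j] = [set w | X s w = j].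
    by apply/seteqP; split => w /= h; [exact: (h 0%N)|case].
  have /(_ s0) := @markov_property _ _ _ _ _ hX k 0 (fun=> s) (fun=> j) t n.
  by rewrite /= HE => <- //; rewrite setIC.
have -> : \sum_(j <- A) p k j s = fine (P k [set w | X s w \in A]).
  rewrite -[in RHS](setTI [set _ | _]).
  rewrite (probability_levels (P k) (fun m => mX s m s0))//.
  by apply: eq_bigr => j _; rewrite setTI.
rewrite /transition_prob -/E (measureDI (P k) mE mU) fineD; last 2 first.
- by apply: fin_num_measure; exact: measurableD.
- by apply: fin_num_measure; exact: measurableI.
rewrite addrK ger0_norm ?fine_ge0//.
have mD : measurable (E `\` [set w | X s w \in A]) by exact: measurableD.
rewrite -lee_fin EFinB !fineK ?fin_num_measure// -probability_setC//.
by apply: le_measure; rewrite ?inE//; exact: measurableC.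
Qed.

Variables (up down : int -> R).
Hypothesis hg : has_generator P X (fun k n =>
  if n == k + 1 then up k else if n == k - 1 then down k
  else if n == k then - (up k + down k) else 0).

(** The chain first runs for the short time [s] and then for [t]. All errors thus come from the
    difference quotients of [p k j] at 0, which is why [r] does not depend on [t]. *)
Lemma transition_prob_increments k n : exists r : R -> R,
  r s @[s --> 0^'+] --> 0 /\
  forall t s, 0 <= t -> 0 < s ->
    `|p k n (t + s) - p k n t
      - s * (up k * (p (k + 1) n t - p k n t)
             + down k * (p (k - 1) n t - p k n t))|
    <= s * r s.
Proof.
pose x j s := (p k j s - p k j 0) / s -
  (if j == k + 1 then up k else if j == k - 1 then down k
   else if j == k then - (up k + down k) else 0).
have x0 j : `|x j s| @[s --> 0^'+] --> 0.
  apply/norm_cvg0P; rewrite -[X in _ --> X](subrr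
   (if j == k + 1 then up k else if j == k - 1 then down k
   else if j == k then - (up k + down k) else 0)).
  by apply: cvgB; [exact: hg|exact: cvg_cst].
(* One copy of the sum bounds the mass outside [k - 1], [k], [k + 1]; the other bounds the errors in
   the three retained terms. *)
exists (fun s => 2 * (`|x (k + 1) s| + `|x (k - 1) s| + `|x k s|)); split.
  rewrite -[X in _ --> X](mulr0 2); apply: cvgM; first exact: cvg_cst.
  rewrite -[X in _ --> X]addr0; apply: cvgD => //.
  by rewrite -[X in _ --> X]addr0; apply: cvgD.
move=> t s t0 s0.
have uA : uniq [:: k + 1; k - 1; k] by rewrite /= !inE; lia.
have := chapman_kolmogorov_approx k n (ltW s0) t0 uA.
rewrite !big_cons !big_nil !addr0 [s + t]addrC.
have pE j : p k j s = (j == k)%:R + s * ((if j == k + 1 then up k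
    else if j == k - 1 then down k
    else if j == k then - (up k + down k) else 0) + x j s).
  by rewrite /x subrKC -(transition_prob0 k j); field; rewrite gt_eqF.
have ne1 : (k + 1 == k) = false by lia.
have ne2 : (k - 1 == k) = false by lia.
have ne3 : (k - 1 == k + 1) = false by lia.
have E1 : p k (k + 1) s = s * (up k + x (k + 1) s).
  by rewrite pE eqxx ne1 add0r.
have E2 : p k (k - 1) s = s * (down k + x (k - 1) s).
  by rewrite pE eqxx ne2 ne3 add0r.
have E3 : p k k s = 1 + s * (- (up k + down k) + x k s).
  by rewrite pE eqxx ![k == _]eq_sym ne1 ne2.
rewrite E1 E2 E3.
have b j : 0 <= p j n t <= 1.
  by rewrite transition_prob_ge0 transition_prob_le1.
have := b (k + 1); have := b (k - 1); have := b k.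
move: (p (k + 1) n t) (p (k - 1) n t) (p k n t) (p k n (t + s)) => y1 y2 y3 y.
move: (x (k + 1) s) (x (k - 1) s) (x k s) => x1 x2 x3 b3 b2 b1.
have xy (a c : R) : 0 <= c <= 1 -> `|a * c| <= `|a|.
  by case/andP=> c0 c1; rewrite normrM (ger0_norm c0) ler_piMr.
have z1 := xy x1 _ b1; have z2 := xy x2 _ b2; have z3 := xy x3 _ b3.
set S := (X in `|y - X|) => yS.
set V := (X in _ - s * X).
have -> : y - y3 - s * V = (y - S) + s * (x1 * y1 + x2 * y2 + x3 * y3).
  by rewrite /V /S; ring.
rewrite (le_trans (ler_normD _ _))// normrM (gtr0_norm s0).
have h1 : `|y - S| <= s * (`|x1| + `|x2| + `|x3|).
  apply: (le_trans yS).
  (* The rates in row [k] add up to 0, so the missing mass consists of the errors alone. *)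
  rewrite [leLHS](_ : _ = s * - (x1 + x2 + x3)); last by ring.
  rewrite ler_pM2l// (le_trans (ler_norm _))// normrN.
  by rewrite (le_trans (ler_normD _ _))// lerD2r ler_normD.
have h2 : s * `|x1 * y1 + x2 * y2 + x3 * y3| <= s * (`|x1| + `|x2| + `|x3|).
  rewrite ler_pM2l// (le_trans (ler_normD _ _))// lerD//.
  by rewrite (le_trans (ler_normD _ _))// lerD.
lra.
Qed.

(** The drift [v] is bounded since probabilities lie between 0 and 1, and left-continuous since the
    increment estimate holds from every starting state. *)
Lemma transition_prob_backward n :
  backward_solution up down (fun k => p k n).
Proof.
pose v k t := up k * (p (k + 1) n t - p k n t)
  + down k * (p (k - 1) n t - p k n t).
have vC k t : 0 <= t -> `|v k t| <= `|up k| + `|down k|.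
  move=> t0; rewrite (le_trans (ler_normD _ _))// !normrM.
  have pB j : `|p j n t - p k n t| <= 1.
    have := transition_prob_le1 j n t0; have := transition_prob_ge0 j n t.
    have := transition_prob_le1 k n t0; have := transition_prob_ge0 k n t.
    by rewrite ler_norml; lra.
  by rewrite lerD// ler_piMr.
move=> k; have [r [r0 hr]] := transition_prob_increments k n; split.
  exact: increments_cvg_right0 hr r0 (vC k).
move=> t t0; apply: (@increments_is_derive _ (p k n) (v k) r hr r0 _ t0).
have cp j : p j n (t - s) @[s --> 0^'+] --> p j n t.
  have [rj [rj0 hrj]] := transition_prob_increments j n.
  exact: increments_cvg_left hrj rj0 (vC j) _ t0.
by apply: cvgD; apply: cvgM; try exact: cvg_cst; apply: cvgB.
Qed.

End nearest_neighbour.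

(** * The closed formula: exponential modes and bounds *)

Section explicit_solution.
Variable R : realType.
Implicit Types A B al be z h t : R.

(* One parity class of the closed formula, stripped of [z ^ k]: [A] and [B]
   are the total rates of this class and of the other one, and [al] is
   [a1 * z ^+ 2 + a2] for the rates of this class. *)
Definition class_factor A B al z h t : R :=
  expR (- ((A + B) / 2) * t) *
  (cosh (t * h / z) + ((B - A) * z / 2 + al) / h * sinh (t * h / z)).

Lemma class_factorE A B al z h t : z != 0 ->
  class_factor A B al z h t =
  (1 + ((B - A) * z / 2 + al) / h) / 2 * expR ((h / z - (A + B) / 2) * t) +
  (1 - ((B - A) * z / 2 + al) / h) / 2 * expR ((- (h / z) - (A + B) / 2) * t).
Proof.
move=> z0; rewrite /class_factor /cosh /sinh; set r := _ / h.
have -> : (h / z - (A + B) / 2) * t = - ((A + B) / 2) * t + t * h / z by field.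
have -> : (- (h / z) - (A + B) / 2) * t = - ((A + B) / 2) * t + - (t * h / z).
  by field.
by rewrite !expRD; field.
Qed.

Lemma class_factor0 A B al z h : class_factor A B al z h 0 = 1.
Proof.
rewrite /class_factor /cosh /sinh !mulr0 !mul0r oppr0 expR0 subrr mul0r mulr0.
by rewrite addr0 mul1r -[1 + 1]/2%:R divff.
Qed.

(** The mode coefficients of the two classes form an eigenvector of the matrix with rows
    [(- A, al / z)] and [(be / z, - B)], for the eigenvalue [h / z - (A + B) / 2]; this is the first
    row. The hypothesis on [h ^+ 2] is the characteristic equation. *)
Lemma eigen_identity A B al be z h : z != 0 -> h != 0 -> al != 0 ->
  h ^+ 2 = ((A - B) * z / 2) ^+ 2 + al * be ->
  (h / z - (A + B) / 2) * ((1 + ((B - A) * z / 2 + al) / h) / 2) =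
  al / z * ((1 + ((A - B) * z / 2 + be) / h) / 2)
  - A * ((1 + ((B - A) * z / 2 + al) / h) / 2).
Proof.
move=> z0 h0 al0 h2.
(* Eliminating [be] leaves an identity of rational functions. *)
have -> : be = (h ^+ 2 - ((A - B) * z / 2) ^+ 2) / al.
  by rewrite h2; field.
by field; rewrite z0 h0 al0.
Qed.

Lemma is_derive_class_factor A B al be z h t : z != 0 -> h != 0 -> al != 0 ->
  h ^+ 2 = ((A - B) * z / 2) ^+ 2 + al * be ->
  is_derive t 1 (class_factor A B al z h)
    (al / z * class_factor B A be z h t - A * class_factor A B al z h t).
Proof.
move=> z0 h0 al0 h2; rewrite !class_factorE//.
rewrite (funext (fun s => class_factorE A B al h s z0)).
have ? := is_derive_expRM (h / z - (A + B) / 2) t.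
have ? := is_derive_expRM (- (h / z) - (A + B) / 2) t.
have e1 := eigen_identity z0 h0 al0 h2.
(* Only [h ^+ 2] is constrained, so [- h] gives the second mode. *)
have hN0 : - h != 0 by rewrite oppr_eq0.
have := eigen_identity z0 hN0 al0; rewrite sqrrN => /(_ _ _ _ h2).
rewrite invrN !mulrN !mulNr => e2.
apply: is_derive_eq; rewrite /GRing.scale/= [B + A]addrC.
rewrite [X in X + _ = _]mulrCA [X in X + _ = _]mulrA e1.
rewrite [X in _ + X = _]mulrCA [X in _ + X = _]mulrA e2.
by ring.
Qed.

(** With [r] the coefficient of [sinh], the value is [e2 + (1 + r) / 2 * (e1 - e2)] with [e1 >= e2],
    and the hypothesis on [- h] says [r >= - 1]: hence the lower bound. For the upper one, no mode
    coefficient exceeds half of 1 plus the absolute value of [r]. *)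
Lemma class_factor_bounds A B al z h tau t : 0 < z -> 0 < h ->
  0 <= A -> 0 <= B -> - h <= (B - A) * z / 2 + al -> 0 <= t <= tau ->
  expR ((- (h / z) - (A + B) / 2) * tau) <= class_factor A B al z h t
   <= (1 + `|((B - A) * z / 2 + al) / h|) * expR (h / z * tau).
Proof.
move=> z0 h0 A0 B0 hr /andP[t0 ttau]; rewrite class_factorE ?gt_eqF//.
set r := _ / h; have r1 : - 1 <= r by rewrite ler_pdivlMr// mulN1r.
have hz : 0 < h / z by rewrite divr_gt0.
set c := (A + B) / 2; have c0 : 0 <= c by rewrite divr_ge0// addr_ge0.
set e1 := expR ((h / z - c) * t); set e2 := expR ((- (h / z) - c) * t).
have e21 : e2 <= e1 by rewrite ler_expR ler_wpM2r//; lra.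
have lb : expR ((- (h / z) - c) * tau) <= e2.
  by rewrite ler_expR ler_wnM2l//; lra.
have ub : e1 <= expR (h / z * tau).
  rewrite ler_expR (@le_trans _ _ (h / z * t))//.
    by rewrite ler_wpM2r//; lra.
  by rewrite ler_pM2l.
have e20 : 0 <= e2 by exact: expR_ge0.
have r2 := ler_norm r; have r3 : 0 <= `|r| by [].
apply/andP; split; first by nra.
apply: (@le_trans _ _ ((1 + `|r|) * e1)).
  by have [] := ler0P r; nra.
by rewrite ler_wpM2l//; lra.
Qed.

End explicit_solution.

(** * The formula for alternating rates *)

Section alternating.
Context (R : realType) (a1 a2 b1 b2 : R).
Hypotheses (ha1 : 0 < a1) (ha2 : 0 < a2) (hb1 : 0 < b1) (hb2 : 0 < b2).
Implicit Types (z t : R) (k n : int).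
Local Notation h := (h_fun a1 a2 b1 b2).
Local Notation A := (a1 + a2).
Local Notation B := (b1 + b2).

Definition up_rate k : R := if (2 %| k)%Z then a1 else b1.
Definition down_rate k : R := if (2 %| k)%Z then a2 else b2.

Definition gf_formula z k t : R := z ^ k *
  (if (2 %| k)%Z then class_factor A B (a1 * z ^+ 2 + a2) z (h z) t
   else class_factor B A (b1 * z ^+ 2 + b2) z (h z) t).

Lemma gf_formulaE z k t : gf_formula z k t =
  z ^ k * expR (- ((a1 + a2 + b1 + b2) / 2) * t)
    * (cosh (t * h z / z) + c_fun a1 a2 b1 b2 k z / h z * sinh (t * h z / z)).
Proof.
rewrite /gf_formula /class_factor /c_fun.
have -> : B + A = a1 + a2 + b1 + b2 by ring.
by case: ifP => _; rewrite mulrA !addrA.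
Qed.

Lemma rate_form_gt0 (c1 c2 z : R) : 0 < c1 -> 0 < c2 -> 0 < c1 * z ^+ 2 + c2.
Proof. by move=> c10 c20; rewrite ltr_wpDl// mulr_ge0 ?sqr_ge0// ltW. Qed.

Lemma h_fun_sqr z : h z ^+ 2 =
  ((A - B) * z / 2) ^+ 2 + (a1 * z ^+ 2 + a2) * (b1 * z ^+ 2 + b2).
Proof.
rewrite /h_fun exprMn sqr_sqrtr; first by field.
have al0 := ltW (rate_form_gt0 z ha1 ha2).
have be0 := ltW (rate_form_gt0 z hb1 hb2).
apply: addr_ge0; first by apply: mulr_ge0; exact: sqr_ge0.
by apply: mulr_ge0 => //; apply: mulr_ge0.
Qed.

Lemma h_fun_gt0 z : 0 < h z.
Proof.
have h0 : 0 <= h z by rewrite mulr_ge0 ?sqrtr_ge0// divr_ge0.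
rewrite lt_neqAle h0 andbT eq_sym -sqrf_eq0 h_fun_sqr gt_eqF//.
by rewrite ltr_wpDl ?sqr_ge0// mulr_gt0//; exact: rate_form_gt0.
Qed.

(** The product in [h_fun_sqr] is nonnegative. The bound supplies the condition on [- h] in
    [class_factor_bounds] for both classes. *)
Lemma h_fun_ge z : `|(A - B) * z / 2| <= h z.
Proof.
rewrite -ler_sqr ?nnegrE ?(ltW (h_fun_gt0 z))// -normrX ger0_norm ?sqr_ge0//.
by rewrite h_fun_sqr lerDl mulr_ge0//; apply/ltW/rate_form_gt0.
Qed.

Lemma dvdz2D1 k : (2 %| k + 1)%Z = ~~ (2 %| k)%Z.
Proof. by apply/idP/idP; lia. Qed.

Lemma dvdz2B1 k : (2 %| k - 1)%Z = ~~ (2 %| k)%Z.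
Proof. by apply/idP/idP; lia. Qed.

Lemma gf_formula0 z k : gf_formula z k 0 = z ^ k.
Proof. by rewrite /gf_formula !class_factor0; case: ifP; rewrite mulr1. Qed.

(** A jump changes the parity class and multiplies [z ^ k] by [z] or [z^-1]. For even [k] the
    neighbour terms thus carry the factor [a1 * z + a2 / z = (a1 * z ^+ 2 + a2) / z]; odd [k] is
    analogous. *)
Lemma gf_formula_is_derive z k t : 0 < z -> is_derive t 1 (gf_formula z k)
  (up_rate k * (gf_formula z (k + 1) t - gf_formula z k t)
   + down_rate k * (gf_formula z (k - 1) t - gf_formula z k t)).
Proof.
move=> z0; have zN0 : z != 0 by rewrite gt_eqF.
have hN0 : h z != 0 by rewrite gt_eqF// h_fun_gt0.
have alN0 : a1 * z ^+ 2 + a2 != 0 by rewrite gt_eqF// rate_form_gt0.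
have beN0 : b1 * z ^+ 2 + b2 != 0 by rewrite gt_eqF// rate_form_gt0.
have h2' : h z ^+ 2 =
    ((B - A) * z / 2) ^+ 2 + (b1 * z ^+ 2 + b2) * (a1 * z ^+ 2 + a2).
  by rewrite h_fun_sqr; field.
rewrite /gf_formula /up_rate /down_rate dvdz2D1 dvdz2B1.
rewrite !expfzDr// expr1z -invr_expz expr1z.
have [k2|k2] := boolP (2 %| k)%Z; rewrite /=.
  have ? := is_derive_class_factor t zN0 hN0 alN0 (h_fun_sqr z).
  by apply: is_derive_eq; rewrite /GRing.scale/=; field.
have ? := is_derive_class_factor t zN0 hN0 beN0 h2'.
by apply: is_derive_eq; rewrite /GRing.scale/=; field.
Qed.

Lemma gf_formula_backward z : 0 < z ->
  backward_solution up_rate down_rate (gf_formula z).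
Proof.
move=> z0 k; split; last by move=> t _; exact: gf_formula_is_derive.
apply: cvg_at_right_filter.
have [/derivable1_diffP d _] := gf_formula_is_derive k 0 z0.
exact: differentiable_continuous.
Qed.

(** There are only two parity classes, so the constants are uniform in [k]. The positive [de] later
    lets moments of base [y] and [y^-1] dominate those of base [z]. *)
Lemma gf_formula_bounds z (tau : R) : 0 < z ->
  exists de C : R, [/\ 0 < de, 0 <= C & forall k t, 0 <= t <= tau ->
    de * z ^ k <= gf_formula z k t <= C * z ^ k].
Proof.
move=> z0; have h0 := h_fun_gt0 z; have := h_fun_ge z; rewrite ler_norml.
have al0 : 0 < a1 * z ^+ 2 + a2 by exact: rate_form_gt0.
have be0 : 0 < b1 * z ^+ 2 + b2 by exact: rate_form_gt0.
move=> /andP[hA hB].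
pose e := expR (h z / z * tau).
pose r0 := `|((B - A) * z / 2 + (a1 * z ^+ 2 + a2)) / h z|.
pose r1 := `|((A - B) * z / 2 + (b1 * z ^+ 2 + b2)) / h z|.
(* Both [r0] and [r1] enter so that one constant serves both classes. *)
exists (expR ((- (h z / z) - (A + B) / 2) * tau)), ((1 + r0 + r1) * e).
have r00 : 0 <= r0 by exact: normr_ge0.
have r10 : 0 <= r1 by exact: normr_ge0.
have e0 : 0 <= e by exact: expR_ge0.
have r0e : 0 <= r0 * e by exact: mulr_ge0.
have r1e : 0 <= r1 * e by exact: mulr_ge0.
split; [exact: expR_gt0|by rewrite mulr_ge0// !addr_ge0|].
move=> k t ht; rewrite /gf_formula ![_ * z ^ k]mulrC !ler_pM2l ?exprz_gt0//.
have A0 : 0 <= A by rewrite addr_ge0// ltW.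
have B0 : 0 <= B by rewrite addr_ge0// ltW.
case: ifP => _.
  have hr : - h z <= (B - A) * z / 2 + (a1 * z ^+ 2 + a2) by lra.
  case/andP: (class_factor_bounds z0 h0 A0 B0 hr ht) => -> ub /=.
  by apply: (le_trans ub); rewrite -/r0 -/e; lra.
have hr : - h z <= (A - B) * z / 2 + (b1 * z ^+ 2 + b2) by lra.
rewrite [A + B]addrC.
case/andP: (class_factor_bounds z0 h0 B0 A0 hr ht) => -> ub /=.
by apply: (le_trans ub); rewrite -/r1 -/e; lra.
Qed.

End alternating.

(** * Truncated generating functions and their limit *)

(** According to the sign of [k], the left side is the [absz k]-th power of [c * x] or of
    [c * x^-1], and one term on the right is that power of [y]. The case [c = 2] offsets the weight
    [2^-1 ^+ N]; the case [c = 1] dominates a square. *)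
Lemma exprz_le_sym (R : realFieldType) (c x y : R) (k : int) :
  0 <= c -> 0 < x -> c * x <= y -> c * x^-1 <= y ->
  c ^+ absz k * x ^ k <= y ^ k + y^-1 ^ k.
Proof.
move=> c0 x0 cx cx'.
have y0 : 0 <= y by apply: le_trans cx; rewrite mulr_ge0// ltW.
have x'0 : 0 <= x^-1 by rewrite invr_ge0 ltW.
case: k => n.
  rewrite -!exprnP -exprMn (le_trans (y := y ^+ n))//.
    by rewrite lerXn2r ?nnegrE// mulr_ge0// ltW.
  by rewrite lerDl exprn_ge0 ?invr_ge0.
rewrite NegzE -!exprnN -!exprVn invrK /= -exprMn.
rewrite (le_trans (y := y ^+ n.+1))//.
  by rewrite lerXn2r ?nnegrE// mulr_ge0.
by rewrite lerDr exprn_ge0 ?invr_ge0.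
Qed.

Section generating_function.
Context (R : realType) (a1 a2 b1 b2 : R) (d : measure_display)
  (T : measurableType d) (P : int -> probability T R) (X : R -> T -> int).
Hypotheses (ha1 : 0 < a1) (ha2 : 0 < a2) (hb1 : 0 < b1) (hb2 : 0 < b2).
Hypothesis hX : is_markov_chain P X.
Hypothesis hg : has_generator P X (alternating_rate a1 a2 b1 b2).
Local Notation p := (transition_prob P X).
Local Notation up := (up_rate a1 b1).
Local Notation down := (down_rate a2 b2).
Local Notation gf := (gf_formula a1 a2 b1 b2).

Definition partial_gf (z : R) (N : nat) (k : int) (t : R) : R :=
  \sum_(n <- zball N) z ^ n * p k n t.

Lemma partial_gf_backward z N : backward_solution up down (partial_gf z N).
Proof.
(* [alternating_rate] unfolds to the rates [up] and [down], so [hg] applies by conversion. *)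
by apply: (@backward_solution_sum _ _ _ _ _ (fun n => z ^ n)
  (fun n k => p k n)) => n;
  exact: (@transition_prob_backward _ _ _ P X hX up down hg n).
Qed.

Lemma partial_gf0 z N k :
  partial_gf z N k 0 = if (absz k <= N)%N then z ^ k else 0.
Proof.
rewrite -mem_zball /partial_gf; under eq_bigr do rewrite (transition_prob0 hX).
case: ifPn => kN.
  rewrite (bigD1_seq k) ?zball_uniq//= eqxx mulr1 big1 ?addr0// => n nk.
  by rewrite (negbTE nk) mulr0.
rewrite big1_seq// => n /= nN; case: eqP => [nk|]; last by rewrite mulr0.
by rewrite -nk nN in kN.
Qed.

Lemma partial_gf_ge0 z N k t : 0 < z -> 0 <= partial_gf z N k t.
Proof.
move=> z0; apply: sumr_ge0 => n _.
by rewrite mulr_ge0 ?transition_prob_ge0// ltW// exprz_gt0.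
Qed.

Let up_ge0 k : 0 <= up k.
Proof. by rewrite /up_rate; case: ifP => _; exact: ltW. Qed.

Let down_ge0 k : 0 <= down k.
Proof. by rewrite /down_rate; case: ifP => _; exact: ltW. Qed.

Let rate_le k : up k + down k <= a1 + a2 + (b1 + b2).
Proof.
by rewrite /up_rate /down_rate; case: ifP => _;
  have := ltW ha1; have := ltW ha2; have := ltW hb1; have := ltW hb2; lra.
Qed.

Lemma partial_gf_le z N k t : 0 < z -> 0 <= t -> partial_gf z N k t <= gf z k t.
Proof.
move=> z0 t0; rewrite -subr_ge0.
pose D k t := 1 * gf z k t + (-1) * partial_gf z N k t.
have -> : gf z k t - partial_gf z N k t = D k t by rewrite /D; ring.
have hD : backward_solution up down D.
  by apply: backward_solutionD; [exact: gf_formula_backward|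
    exact: partial_gf_backward].
have tt : 0 <= t <= t by rewrite t0 lexx.
(* The formula is nonnegative and probabilities are at most 1, so [D] never falls below minus the
   sum of [z ^ n] over [zball N]. *)
apply: (@backward_solution_ge0 _ _ _ _ _ (\sum_(n <- zball N) z ^ n) D
  up_ge0 down_ge0 rate_le hD _ _ k t tt).
  move=> j; rewrite /D gf_formula0 partial_gf0; case: ifP => _.
    by rewrite mul1r mulN1r subrr.
  by rewrite mulr0 addr0 mul1r ltW// exprz_gt0.
move=> j s hs; have [de [C [de0 _ /(_ j s hs)/andP[h1 _]]]] :=
  gf_formula_bounds ha1 ha2 hb1 hb2 t z0.
have g0 : 0 <= gf z j s.
  by apply: le_trans h1; rewrite mulr_ge0// ltW// exprz_gt0.
have : partial_gf z N j s <= \sum_(n <- zball N) z ^ n.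
  apply: ler_sum => n _; rewrite ler_piMr ?transition_prob_le1//.
    by rewrite ltW// exprz_gt0.
  by case/andP: hs.
by rewrite /D; lra.
Qed.

(* At time 0 the tail [z ^ k] outside [zball N] is at most
   [2 ^- N * (y ^ k + y ^ (- k))], and this larger exponential moment also
   keeps the difference bounded below, as [de * x ^+ 2 - C * x] is in
   [x = z ^ k]. *)
Lemma gf_le_partial_gf z y N k t : 0 < z -> 0 <= t ->
  2 * z <= y -> 2 * z^-1 <= y -> z ^+ 2 <= y -> (z ^+ 2)^-1 <= y ->
  gf z k t - 2^-1 ^+ N * (gf y k t + gf y^-1 k t) <= partial_gf z N k t.
Proof.
move=> z0 t0 hy1 hy2 hy3 hy4.
have y0 : 0 < y by apply: lt_le_trans hy1; rewrite mulr_gt0.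
have y'0 : 0 < y^-1 by rewrite invr_gt0.
have [de1 [C1 [de10 _ bd1]]] := gf_formula_bounds ha1 ha2 hb1 hb2 t y0.
have [de2 [C2 [de20 _ bd2]]] := gf_formula_bounds ha1 ha2 hb1 hb2 t y'0.
have [de [C [_ C0 bd]]] := gf_formula_bounds ha1 ha2 hb1 hb2 t z0.
set ep := 2^-1 ^+ N; have ep0 : 0 < ep by rewrite exprn_gt0.
pose W k t := ep * gf y k t + ep * gf y^-1 k t.
pose S k t := 1 * partial_gf z N k t + (-1) * gf z k t.
pose D k t := 1 * W k t + 1 * S k t.
rewrite -subr_ge0.
rewrite [leRHS](_ : _ = D k t); last by rewrite /D /W /S; ring.
have hD : backward_solution up down D.
  apply: backward_solutionD; apply: backward_solutionD.
  - exact: gf_formula_backward.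
  - exact: gf_formula_backward.
  - exact: partial_gf_backward.
  - exact: gf_formula_backward.
have tt : 0 <= t <= t by rewrite t0 lexx.
(* The minimum gives one constant for both bases [y] and [y^-1]. *)
set m := ep * Num.min de1 de2.
have m0 : 0 < m by rewrite mulr_gt0// lt_min de10.
(* With [x = z ^ j], [D] is at least [m * x ^+ 2 - C * x], which is at least [- (C ^+ 2 / m)]. *)
apply: (@backward_solution_ge0 _ _ _ _ _ (C ^+ 2 / m) D
  up_ge0 down_ge0 rate_le hD _ _ k t tt) => [j|j s hs].
  have zj : 0 < z ^ j by rewrite exprz_gt0.
  have yj : 0 < y ^ j by rewrite exprz_gt0.
  have y'j : 0 < y^-1 ^ j by rewrite exprz_gt0.
  rewrite /D /W /S !gf_formula0 partial_gf0; case: ifPn => [_|].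
    rewrite mulN1r !mul1r subrr addr0 -mulrDr.
    by rewrite mulr_ge0 ?addr_ge0// ltW.
  rewrite -ltnNge => /ltnW Nj.
  have ymom := exprz_le_sym j (ler0n _ 2) z0 hy1 hy2.
  have ep2 : 1 <= ep * 2 ^+ absz j.
    rewrite /ep exprVn mulrC ler_pdivlMr ?exprn_gt0// mul1r.
    by rewrite ler_eXn2l// ltr1n.
  have h1 : z ^ j <= ep * 2 ^+ absz j * z ^ j by rewrite ler_peMl// ltW.
  have h2 : ep * 2 ^+ absz j * z ^ j <= ep * (y ^ j + y^-1 ^ j).
    by rewrite -mulrA ler_pM2l.
  by lra.
have zj : 0 < z ^ j by rewrite exprz_gt0.
have yj : 0 < y ^ j by rewrite exprz_gt0.
have y'j : 0 < y^-1 ^ j by rewrite exprz_gt0.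
have /andP[l1 _] := bd1 j s hs; have /andP[l2 _] := bd2 j s hs.
have /andP[_ u3] := bd j s hs.
have := partial_gf_ge0 N j s z0.
(* The conditions that [y] dominates [z ^+ 2] and its inverse serve here. *)
have zz : z ^ j * z ^ j <= y ^ j + y^-1 ^ j.
  have := @exprz_le_sym _ 1 (z ^+ 2) y j ler01.
  rewrite !mul1r expr1n mul1r expr2 expfzMl; apply => //.
  by rewrite -expr2 exprn_gt0.
have g1 : m * y ^ j <= ep * gf y j s.
  rewrite /m -mulrA ler_pM2l// (le_trans _ l1)// ler_pM2r//.
  by rewrite ge_min lexx.
have g2 : m * y^-1 ^ j <= ep * gf y^-1 j s.
  rewrite /m -mulrA ler_pM2l// (le_trans _ l2)// ler_pM2r//.
  by rewrite ge_min lexx orbT.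
have g3 : m * (z ^ j * z ^ j) <= m * y ^ j + m * y^-1 ^ j.
  by rewrite -mulrDr ler_pM2l.
pose q := C / m; have Cq : C = m * q by rewrite /q mulrC divfK// gt_eqF.
have -> : C ^+ 2 / m = m * q ^+ 2 by rewrite Cq; field; rewrite gt_eqF.
have : 0 <= m * (z ^ j * z ^ j - q * z ^ j + q ^+ 2).
  by rewrite mulr_ge0 ?(ltW m0)//; nra.
by move: u3; rewrite /D /W /S Cq; lra.
Qed.

Lemma partial_gf_cvg z k t : 0 < z -> 0 <= t ->
  partial_gf z N k t @[N --> \oo] --> gf z k t.
Proof.
(* A sum of four positive terms, each of which [y] has to dominate. *)
move=> z0 t0; pose y := 2 * z + 2 * z^-1 + z ^+ 2 + (z ^+ 2)^-1.
have z1 : 0 < z^-1 by rewrite invr_gt0.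
have z2 : 0 < z ^+ 2 by rewrite exprn_gt0.
have z3 : 0 < (z ^+ 2)^-1 by rewrite invr_gt0.
apply: (@squeeze_cvgr _ _ _ _
  (fun N => gf z k t - 2^-1 ^+ N * (gf y k t + gf y^-1 k t))
  (fun=> gf z k t)).
- apply: nearW => N; rewrite partial_gf_le// andbT.
  by apply: gf_le_partial_gf => //; rewrite /y; lra.
- rewrite -[X in _ --> X]subr0; apply: cvgB; first exact: cvg_cst.
  rewrite -[X in _ --> X](mul0r (gf y k t + gf y^-1 k t)).
  by apply: cvgM; [apply: cvg_expr; rewrite ger0_norm; lra|exact: cvg_cst].
- exact: cvg_cst.
Qed.

End generating_function.

Theorem proposition3p1 (R : realType) (a1 a2 b1 b2 : R)
    (d : measure_display) (T : measurableType d)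
    (P : int -> probability T R) (X : R -> T -> int)
    (ha1 : 0 < a1) (ha2 : 0 < a2) (hb1 : 0 < b1) (hb2 : 0 < b2)
    (hX : is_markov_chain P X)
    (hg : has_generator P X (alternating_rate a1 a2 b1 b2))
    (k : int) (t : R) (ht : 0 <= t) (z : R) (hz : 0 < z) :
  gen_fun P X k z t =
    (\esum_(n in [set: int]) (z ^ n * transition_prob P X k n t)%:E)%E
  /\
  gen_fun P X k z t =
    (z ^ k * expR (- ((a1 + a2 + b1 + b2) / 2) * t)
     * (cosh (t * h_fun a1 a2 b1 b2 z / z)
        + c_fun a1 a2 b1 b2 k z / h_fun a1 a2 b1 b2 z
          * sinh (t * h_fun a1 a2 b1 b2 z / z)))%:E.
Proof.
have mX := fun n => @markov_measurable _ _ _ _ _ hX t n ht.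
have z0 n : 0 <= z ^ n by rewrite ltW// exprz_gt0.
split; first exact: expectation_esum.
(* The truncated sums tend to the expectation and also to the formula, so the two limits agree. *)
have := expectation_zball (mu := P k) mX z0.
have := partial_gf_cvg ha1 ha2 hb1 hb2 hX hg hz ht.
rewrite -gf_formulaE => c1 c2; apply: cvg_unique c2 _ => //.
by apply: cvg_EFin; [exact: nearW|exact: c1].
Qed.
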